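(* Let $\mathcal U\subset\mathbb C$ be a simply connected domain with coordinate $z=x+iy$, let $U:\mathcal U\to\mathbb R$ be a real-valued potential, and let $\psi=\begin{pmatrix}\psi_1\\ \psi_2\end{pmatrix}$ be a nowhere vanishing solution of the Dirac equation $\mathcal D\psi=0$ with potential $U$. Put $\Psi_0=\begin{pmatrix}\psi_1&-\bar\psi_2\\ \psi_2&\bar\psi_1\end{pmatrix}$ and let $S=S(\Psi_0,\Psi_0):\mathcal U\to su(2)\cong\mathbb R^3$ be the surface $$S(P)= S(P_0)+i\int_{P_0}^P\left[\begin{pmatrix}\psi_1\bar\psi_2&-\bar\psi_2^2\\ \psi_1^2&-\psi_1\bar\psi_2\end{pmatrix}dz+\begin{pmatrix}\bar\psi_1\psi_2&\bar\psi_1^2\\ -\psi_2^2&-\bar\psi_1\psi_2\end{pmatrix}d\bar z\right]$$ defined by $\psi$ via the Weierstrass representation, where $P_0\in\mathcal U$ is fixed and $S(P_0)\in su(2)$ is a constant. Assume that $S$ does not pass through $0$. Then the Moutard transformation of $\mathcal D$ determined by $\Psi_0$ (and this choice of $S(\Psi_0,\Psi_0)$) maps the potential $U$ of the Weierstrass representation of $S$ into the potential of the Weierstrass representation (with the same conformal parameter $z$) of the inverted surface $\widetilde S=T\circ S=S^{-1}$. That is, if $$K(\Psi_0)=\Psi_0\,S^{-1}\,\Gamma\,\Psi_0^\top\,\Gamma^{-1},\qquad W=-i\,K(\Psi_0)_{11},$$ then $\widetilde U=U+W$ is the potential of $\widetilde S$.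
   Context: All functions are smooth. Notation: $\partial=\frac12(\partial_x-i\partial_y)$, $\bar\partial=\frac12(\partial_x+i\partial_y)$, $\Gamma=\begin{pmatrix}0&1\\-1&0\end{pmatrix}$, $\sigma_3=\begin{pmatrix}1&0\\0&-1\end{pmatrix}$, and $X^\top$ is the (non-conjugated) transpose. Dirac operator with real-valued potential $U$: $\mathcal D=\begin{pmatrix}0&\partial\\-\bar\partial&0\end{pmatrix}+\begin{pmatrix}U&0\\0&U\end{pmatrix}$. Weierstrass representation: a solution $\psi$ of $\mathcal D\psi=0$ defines, up to translation, a surface $r=(x^1,x^2,x^3):\mathcal U\to\mathbb R^3$ by $$\partial x^1=\tfrac i2(\psi_1^2+\bar\psi_2^2),\quad \partial x^2=\tfrac12(\bar\psi_2^2-\psi_1^2),\quad \partial x^3=\psi_1\bar\psi_2 .$$ It is a conformal immersion where $\psi\neq0$, with induced metric $e^{2\alpha}dz\,d\bar z$, $e^\alpha=|\psi_1|^2+|\psi_2|^2$. Conversely, every conformally immersed surface $r$ with conformal parameter $z$ on a simply connected domain arises this way, and the potential $U$ in its Dirac operator is uniquely determined: $U=e^{-\alpha}\langle r_{z\bar z},\mathbf n\rangle=\frac{e^\alpha H}{2}$, where $H$ is the mean curvature and $$\mathbf n=e^{-\alpha}\big(i(\psi_1\psi_2-\bar\psi_1\bar\psi_2),\,-(\psi_1\psi_2+\bar\psi_1\bar\psi_2),\,|\psi_2|^2-|\psi_1|^2\big)=\frac{r_x\times r_y}{|r_x\times r_y|}$$ is the unit normal. This $U$ is called the potential of the (Weierstrass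 representation of the) surface. Identification $\mathbb R^3\cong su(2)$: $\mathbf x=(x^1,x^2,x^3)\mapsto\mathbf X=\begin{pmatrix}ix^3&-x^1-ix^2\\ x^1-ix^2&-ix^3\end{pmatrix}$. The inversion is $T:\mathbf x\mapsto-\mathbf x/|\mathbf x|^2$, which in matrix form is $T(\mathbf X)=\mathbf X^{-1}$. Moutard transformation: for matrix functions $\Phi,\Psi$ of the form $\begin{pmatrix}a&b\\-\bar b&\bar a\end{pmatrix}$ set $\omega(\Phi,\Psi)=\Phi^\top\Psi\,dy-i\,\Phi^\top\sigma_3\Psi\,dx$ and $S(\Phi,\Psi)=\Gamma\int\omega(\Phi,\Psi)$; $S(\Psi_0,\Psi_0)$ is defined up to a constant matrix from $su(2)$, and coincides with the surface $S$ of the claim for the corresponding choice of constant. For $\Psi_0$ as in the claim, $K(\Psi_0)=\Psi_0S^{-1}(\Psi_0,\Psi_0)\Gamma\Psi_0^\top\Gamma^{-1}$ has the form $\begin{pmatrix}iW&a\\-\bar a&-iW\end{pmatrix}$ with $W$ real-valued, and the Moutard transformation determined by $\Psi_0$ replaces the Dirac operator with potential $U$ by the Dirac operator with potential $U+W$. *)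

(* Defs.v *)
From HB Require Import structures.
From mathcomp Require Import all_boot all_order all_algebra.
From mathcomp Require Import complex.
From mathcomp Require Import all_classical all_reals all_analysis.

Set Implicit Arguments.
Unset Strict Implicit.
Unset Printing Implicit Defensive.

Import Order.TTheory GRing.Theory Num.Theory.
Import numFieldNormedType.Exports.

Local Open Scope classical_set_scope.
Local Open Scope complex_scope.
Local Open Scope ring_scope.

(* As a domain of functions, the complex plane is R * R: the pair (x, y) stands
   for z = x + iy. Values are in R[i]; since R[i] carries no normed R-module
   structure, derivatives and integrals of complex functions are taken on real
   and imaginary parts. *)

Section Smoothness.
Variable R : realType.
Implicit Types (Omega : set (R * R)) (f : R * R -> R) (g : R * R -> R[i]).

Definition e_x : R * R := (1, 0).
Definition e_y : R * R := (0, 1).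

Fixpoint Ck (n : nat) Omega f : Prop :=
  (forall p, Omega p -> {for p, continuous f}) /\
  if n is m.+1 then
    [/\ forall p, Omega p -> derivable f p e_x /\ derivable f p e_y,
        Ck m Omega ('D_e_x f) & Ck m Omega ('D_e_y f)]
  else True.

Definition smooth Omega f : Prop := forall n, Ck n Omega f.

Definition csmooth Omega g : Prop :=
  smooth Omega (fun p => complex.Re (g p)) /\
  smooth Omega (fun p => complex.Im (g p)).

Definition cderive (v : R * R) g (p : R * R) : R[i] :=
  'D_v (fun q => complex.Re (g q)) p +i* 'D_v (fun q => complex.Im (g q)) p.

Definition del g p : R[i] :=
  2^-1 * (cderive e_x g p - 'i%C * cderive e_y g p).
Definition delbar g p : R[i] :=
  2^-1 * (cderive e_x g p + 'i%C * cderive e_y g p).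

End Smoothness.

Section Domains.
Variable R : realType.
Implicit Types (Omega : set (R * R)).

Definition simply_connected Omega : Prop :=
  connected Omega /\
  forall gamma : R -> R * R,
    {within `[0, 1], continuous gamma} ->
    (forall t, t \in `[0, 1] -> Omega (gamma t)) ->
    gamma 0 = gamma 1 ->
    exists H : R * R -> R * R,
      {within `[0, 1] `*` `[0, 1], continuous H} /\
      (forall s t, s \in `[0, 1] -> t \in `[0, 1] ->
         [/\ Omega (H (s, t)), H (0, t) = gamma t, H (1, t) = gamma 0 &
             H (s, 0) = gamma 0 /\ H (s, 1) = gamma 0]).

Definition simply_connected_domain Omega : Prop :=
  [/\ open Omega, Omega !=set0 & simply_connected Omega].

(* A C^1 arc on [0, 1] always extends to a C^1 curve on R, so differentiability
   is required on the whole line to avoid one-sided derivatives. *)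
Definition C1_arc (gamma : R -> R * R) : Prop :=
  [/\ forall t, derivable (fun s => (gamma s).1) t 1,
      forall t, derivable (fun s => (gamma s).2) t 1,
      continuous (derive1 (fun s => (gamma s).1)) &
      continuous (derive1 (fun s => (gamma s).2))].

(* A piecewise C^1 path is the list of its successive C^1 arcs, each
   parametrised by [0, 1]. *)
Fixpoint is_path Omega (P Q : R * R) (arcs : seq (R -> R * R)) : Prop :=
  if arcs is gamma :: arcs' then
    [/\ C1_arc gamma, forall t, t \in `[0, 1] -> Omega (gamma t),
        gamma 0 = P & is_path Omega (gamma 1) Q arcs']
  else P = Q.

Definition velocity (gamma : R -> R * R) (t : R) : R[i] :=
  derive1 (fun s => (gamma s).1) t +i* derive1 (fun s => (gamma s).2) t.

Definition cintegral01 (g : R -> R[i]) : R[i] :=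
  (\int[lebesgue_measure]_(t in `[0, 1]) complex.Re (g t)) +i*
  (\int[lebesgue_measure]_(t in `[0, 1]) complex.Im (g t)).

(* The integral of the matrix-valued 1-form A dz + B dzbar along a path. *)
Definition path_integral (A B : R * R -> 'M[R[i]]_2)
    (arcs : seq (R -> R * R)) : 'M[R[i]]_2 :=
  \sum_(gamma <- arcs) \matrix_(i, j)
    cintegral01 (fun t => A (gamma t) i j * velocity gamma t
                        + B (gamma t) i j * conjc (velocity gamma t)).

End Domains.

Section Surfaces.
Variable R : realType.
Local Notation C := R[i].
Implicit Types (Omega : set (R * R)) (psi : R * R -> 'cV[C]_2)
  (U : R * R -> R) (r : R * R -> 'rV[R]_3).

Definition mat2 (a b c d : C) : 'M[C]_2 :=
  \matrix_(i, j) nth 0 (nth [::] [:: [:: a; b]; [:: c; d]] i) j.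

Definition col2 (a b : C) : 'cV[C]_2 := \col_i nth 0 [:: a; b] i.

Definition comp1 psi (p : R * R) : C := psi p 0 0.
Definition comp2 psi (p : R * R) : C := psi p 1 0.

Definition dirac U psi (p : R * R) : 'cV[C]_2 :=
  col2 (del (comp2 psi) p) (- delbar (comp1 psi) p) +
  mat2 (U p)%:C 0 0 (U p)%:C *m psi p.

Definition dirac_solution Omega U psi : Prop :=
  [/\ csmooth Omega (comp1 psi), csmooth Omega (comp2 psi) &
      forall p, Omega p -> dirac U psi p = 0].

Definition nowhere_vanishing Omega psi : Prop :=
  forall p, Omega p -> psi p != 0.

Definition coord r (k : 'I_3) (p : R * R) : R := r p 0 k.

Definition weierstrass_equations Omega psi r : Prop :=
  forall p, Omega p ->
  let psi1 := comp1 psi p in let psi2 := comp2 psi p in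
  [/\ del (fun q => (coord r 0 q)%:C) p
        = 'i%C / 2 * (psi1 ^+ 2 + conjc psi2 ^+ 2),
      del (fun q => (coord r 1 q)%:C) p
        = 2^-1 * (conjc psi2 ^+ 2 - psi1 ^+ 2) &
      del (fun q => (coord r 2 q)%:C) p = psi1 * conjc psi2].

Definition has_weierstrass_potential Omega r U : Prop :=
  [/\ smooth Omega U, forall k, smooth Omega (coord r k) &
      exists psi, [/\ dirac_solution Omega U psi, nowhere_vanishing Omega psi &
                      weierstrass_equations Omega psi r]].

(* U is the potential of the Weierstrass representation of r: it occurs in one,
   and every potential that does agrees with it on Omega. *)
Definition is_potential Omega r U : Prop :=
  has_weierstrass_potential Omega r U /\
  forall V, has_weierstrass_potential Omega r V ->
    forall p, Omega p -> V p = U p.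

(* The identification of R^3 with su(2). *)
Definition su2 (x : 'rV[R]_3) : 'M[C]_2 :=
  let x1 := (x 0 0)%:C in let x2 := (x 0 1)%:C in let x3 := (x 0 2)%:C in
  mat2 ('i%C * x3) (- x1 - 'i%C * x2) (x1 - 'i%C * x2) (- ('i%C * x3)).

Definition inversion (x : 'rV[R]_3) : 'rV[R]_3 :=
  - (\sum_k x 0 k ^+ 2)^-1 *: x.

Definition Gamma : 'M[C]_2 := mat2 0 1 (-1) 0.

Definition Psi0 psi (p : R * R) : 'M[C]_2 :=
  let psi1 := comp1 psi p in let psi2 := comp2 psi p in
  mat2 psi1 (- conjc psi2) psi2 (conjc psi1).

Definition form_dz psi (p : R * R) : 'M[C]_2 :=
  let psi1 := comp1 psi p in let psi2 := comp2 psi p in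
  mat2 (psi1 * conjc psi2) (- conjc psi2 ^+ 2)
       (psi1 ^+ 2) (- (psi1 * conjc psi2)).

Definition form_dzbar psi (p : R * R) : 'M[C]_2 :=
  let psi1 := comp1 psi p in let psi2 := comp2 psi p in
  mat2 (conjc psi1 * psi2) (conjc psi1 ^+ 2)
       (- psi2 ^+ 2) (- (conjc psi1 * psi2)).

(* S(P) = S(P0) + i int_P0^P [form_dz dz + form_dzbar dzbar]; the integral is
   path-independent, and the formula is required along every piecewise C^1 path
   in Omega from P0 to P. As S is R^3-valued, S(P0) is an arbitrary element of
   su(2) under the identification. *)
Definition weierstrass_surface Omega (P0 : R * R) psi
    (S : R * R -> 'rV[R]_3) : Prop :=
  forall P arcs, is_path Omega P0 P arcs ->
    su2 (S P) =
      su2 (S P0) + 'i%C *: path_integral (form_dz psi) (form_dzbar psi) arcs.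

Definition moutard_K psi (S : R * R -> 'rV[R]_3) (p : R * R) : 'M[C]_2 :=
  Psi0 psi p *m invmx (su2 (S p)) *m Gamma *m (Psi0 psi p)^T *m invmx Gamma.

End Surfaces.

(* Main.v *)
Require Import Defs.
From HB Require Import structures.
From mathcomp Require Import all_boot all_order all_algebra.
From mathcomp Require Import complex ring.
From mathcomp Require Import all_classical all_reals all_analysis.

Import Order.TTheory GRing.Theory Num.Theory.
Import numFieldNormedType.Exports.
Local Open Scope classical_set_scope.
Local Open Scope complex_scope.
Local Open Scope ring_scope.
Set Implicit Arguments.
Unset Strict Implicit.
Unset Printing Implicit Defensive.

(** The surface [S] is viewed in su(2), where inversion is [S |-> S^-1].  Its
    derivative [S_z] is [i] times the rank one matrix with column
    [(conj psi2, psi1)] and row [(psi1, - conj psi2)].  Since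
    [(S^-1)_z = - S^-1 S_z S^-1], and transposition against [Gamma] moves
    [S^-1] from the row to the column, [(S^-1)_z] has the same form for the
    spinor [chi] given by [(conj chi2, chi1) = S^-1 (conj psi2, psi1)]
    ([inverted_spinor]).  So [chi] satisfies the Weierstrass equations of the
    inverted surface ([inversion_del], [inversion_weierstrass_equations]), and
    it vanishes nowhere because [S^-1] is invertible.

    The Leibniz rule then gives the Dirac equation of [chi]
    ([inverted_spinor_dirac]).  Differentiating [psi] contributes [U].
    Differentiating [S^-1] contributes
    [W = i (conj chi2 psi2 + chi1 conj psi1)], which is a real function and
    equals [- i K_11] by a computation with 2 x 2 matrices ([moutard_K00]).
    Thus [U + W] is a potential for the inverted surface.

    It is the only one: the Weierstrass equations fix the spinor up to sign at
    each point, and two Wirtinger derivatives of quadratic expressions in the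
    spinor recover the potential ([potential_unique]).

    There remains the analytic input, that [S], which is given by its integrals
    along paths, is smooth and has the expected derivatives.  As [Omega] is open
    and connected, every point of [Omega] is the end of a path of segments from
    [P0] ([path_connected]).  Prolonging it by a short segment expresses the
    increments of [S] by integrals over that segment ([surface_increment]), and
    the fundamental theorem of calculus gives the first derivatives
    ([complex_primitive]).  These are polynomial in [psi], so [S] is smooth. *)

(** * Smooth functions on an open subset of the plane *)

Section SmoothCalculus.
Variable R : realType.
Implicit Types (Omega : set (R * R)) (f g : R * R -> R) (p v : R * R).

Lemma near_eq_continuous f g p : (\forall q \near p, f q = g q) ->
  {for p, continuous f} -> {for p, continuous g}.
Proof.
move=> fg cf; have fgp := nbhs_singleton fg.
rewrite /prop_for /continuous_at -fgp.
exact: cvg_trans (near_eq_cvg fg) cf.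
Qed.

(** Continuity and derivatives are local, so only the values on the open set
    matter. *)
Lemma Ck_ext n Omega f g : open Omega -> (forall p, Omega p -> f p = g p) ->
  Ck n Omega f -> Ck n Omega g.
Proof.
move=> oO; elim: n f g => [|n IH] f g fg [cf Hf].
all: have nfg p (Op : Omega p) : \forall q \near p, f q = g q by
  apply: filterS (open_nbhs_nbhs (conj oO Op)) => q /fg.
  by split=> // p Op; exact: near_eq_continuous (nfg p Op) (cf p Op).
split=> [p Op|]; first exact: near_eq_continuous (nfg p Op) (cf p Op).
have [df dx dy] := Hf; split.
- move=> p Op; have [d1 d2] := df p Op.
  by split; apply: (near_eq_derivable (nfg p Op)).
- by apply: IH dx => p Op; apply: near_eq_derive; exact: nfg.
- by apply: IH dy => p Op; apply: near_eq_derive; exact: nfg.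
Qed.

Lemma CkW n Omega f : Ck n.+1 Omega f -> Ck n Omega f.
Proof.
elim: n f => [|n IH] f [cf [df dx dy]]; first exact: (conj cf I).
exact: (conj cf (And3 df (IH _ dx) (IH _ dy))).
Qed.

Lemma Ck_cst n Omega (c : R) : open Omega -> Ck n Omega (fun=> c).
Proof.
move=> oO; have cc (c' : R) p : {for p, continuous (fun=> c')} by exact: cvg_cst.
elim: n c => [|n IH] c; first exact: (conj (fun p _ => cc c p) I).
split=> [p _|]; [exact: cc | split].
- by move=> p _; split; exact: derivable_cst.
- by apply: (Ck_ext oO _ (IH 0)) => p _; rewrite derive_cst.
- by apply: (Ck_ext oO _ (IH 0)) => p _; rewrite derive_cst.
Qed.

Lemma CkD n Omega f g : open Omega -> Ck n Omega f -> Ck n Omega g ->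
  Ck n Omega (fun p => f p + g p).
Proof.
move=> oO; elim: n f g => [|n IH] f g [cf Hf] [cg Hg].
  by split=> // p Op; apply: cvgD; [exact: cf | exact: cg].
have [df fx fy] := Hf; have [dg gx gy] := Hg; split=> [p Op|].
  by apply: cvgD; [exact: cf | exact: cg].
split.
- move=> p Op; have [fx1 fy1] := df p Op; have [gx1 gy1] := dg p Op.
  exact: (conj (derivableD fx1 gx1) (derivableD fy1 gy1)).
- apply: (Ck_ext oO _ (IH _ _ fx gx)) => p Op.
  by have [f1 _] := df p Op; have [g1 _] := dg p Op; rewrite (deriveD f1 g1).
- apply: (Ck_ext oO _ (IH _ _ fy gy)) => p Op.
  by have [_ f1] := df p Op; have [_ g1] := dg p Op; rewrite (deriveD f1 g1).
Qed.

Lemma CkM n Omega f g : open Omega -> Ck n Omega f -> Ck n Omega g ->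
  Ck n Omega (fun p => f p * g p).
Proof.
move=> oO; elim: n f g => [|n IH] f g Hf Hg.
  have [cf _] := Hf; have [cg _] := Hg.
  by split=> // p Op; apply: cvgM; [exact: cf | exact: cg].
have Hf' := CkW Hf; have Hg' := CkW Hg.
have [cf [df fx fy]] := Hf; have [cg [dg gx gy]] := Hg; split=> [p Op|].
  by apply: cvgM; [exact: cf | exact: cg].
split.
- move=> p Op; have [fx1 fy1] := df p Op; have [gx1 gy1] := dg p Op.
  exact: (conj (derivableM fx1 gx1) (derivableM fy1 gy1)).
- apply: (Ck_ext oO _ (CkD oO (IH _ _ Hf' gx) (IH _ _ Hg' fx))) => p Op.
  by have [f1 _] := df p Op; have [g1 _] := dg p Op; rewrite (deriveM f1 g1).
- apply: (Ck_ext oO _ (CkD oO (IH _ _ Hf' gy) (IH _ _ Hg' fy))) => p Op.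
  by have [_ f1] := df p Op; have [_ g1] := dg p Op; rewrite (deriveM f1 g1).
Qed.

Lemma CkV n Omega f : open Omega -> (forall p, Omega p -> f p != 0) ->
  Ck n Omega f -> Ck n Omega (fun p => (f p)^-1).
Proof.
move=> oO f0; elim: n => [|n IH] Hf.
  by have [cf _] := Hf; split=> // p Op; apply: cvgV; [exact: f0 | exact: cf].
have Hi := IH (CkW Hf).
have [cf [df fx fy]] := Hf; split=> [p Op|].
  by apply: cvgV; [exact: f0 | exact: cf].
have dV v : (forall p, Omega p -> derivable f p v) -> Ck n Omega ('D_v f) ->
    Ck n Omega ('D_v (fun p => (f p)^-1)).
  move=> dfv fv.
  apply: (Ck_ext oO _ (CkM oO (CkM oO (Ck_cst n (-1) oO) (CkM oO Hi Hi)) fv)).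
  move=> p Op; rewrite (deriveV (f0 p Op) (dfv p Op)).
  by rewrite mulN1r expr2 invfM.
split.
- move=> p Op; have [f1 f2] := df p Op; have fp0 := f0 p Op.
  exact: (conj (derivableV fp0 f1) (derivableV fp0 f2)).
- exact: (dV _ (fun p Op => (df p Op).1) fx).
- exact: (dV _ (fun p Op => (df p Op).2) fy).
Qed.

Lemma smooth_ext Omega f g : open Omega -> (forall p, Omega p -> f p = g p) ->
  smooth Omega f -> smooth Omega g.
Proof. by move=> oO fg Hf n; exact: Ck_ext (Hf n). Qed.

Lemma smooth_cst Omega (c : R) : open Omega -> smooth Omega (fun=> c).
Proof. by move=> oO n; exact: Ck_cst. Qed.

Lemma smoothD Omega f g : open Omega -> smooth Omega f -> smooth Omega g ->
  smooth Omega (fun p => f p + g p).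
Proof. by move=> oO Hf Hg n; exact: CkD. Qed.

Lemma smoothM Omega f g : open Omega -> smooth Omega f -> smooth Omega g ->
  smooth Omega (fun p => f p * g p).
Proof. by move=> oO Hf Hg n; exact: CkM. Qed.

Lemma smoothN Omega f : open Omega -> smooth Omega f ->
  smooth Omega (fun p => - f p).
Proof.
move=> oO Hf; apply: (smooth_ext oO _ (smoothM oO (smooth_cst (-1) oO) Hf)).
by move=> p _; rewrite mulN1r.
Qed.

Lemma smoothV Omega f : open Omega -> (forall p, Omega p -> f p != 0) ->
  smooth Omega f -> smooth Omega (fun p => (f p)^-1).
Proof. by move=> oO f0 Hf n; exact: CkV. Qed.

Lemma smooth_derivable Omega f p : smooth Omega f -> Omega p ->
  derivable f p (e_x R) /\ derivable f p (e_y R).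
Proof. by move=> /(_ 1%N)[_ [df _ _]]; exact: df. Qed.

Lemma smooth_continuous Omega f p : smooth Omega f -> Omega p ->
  {for p, continuous f}.
Proof. by move=> /(_ 0%N)[cf _]; exact: cf. Qed.

(** Smoothness of a primitive is read off its gradient.  Continuity of [f] is a
    separate hypothesis because it does not follow from the mere existence of
    partial derivatives. *)
Lemma smooth_of_partials Omega f fx fy : open Omega ->
  (forall p, Omega p -> [/\ {for p, continuous f},
     is_derive p (e_x R) f (fx p) & is_derive p (e_y R) f (fy p)]) ->
  smooth Omega fx -> smooth Omega fy -> smooth Omega f.
Proof.
move=> oO H sx sy n.
have cf p : Omega p -> {for p, continuous f} by case/H.
case: n => [|n]; first by split.
split=> //; split.
- by move=> p /H[_ [? _] [? _]]; split.
- by apply: (Ck_ext oO _ (sx n)) => p /H[_ [_ ->]].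
- by apply: (Ck_ext oO _ (sy n)) => p /H[_ _ [_ ->]].
Qed.

End SmoothCalculus.

(** * Wirtinger derivatives *)

Section ComplexCalculus.
Variable R : realType.
Implicit Types (Omega : set (R * R)) (f g : R * R -> R[i]) (p v : R * R).

Local Notation Re := (@complex.Re R).
Local Notation Im := (@complex.Im R).
Local Notation ex := (e_x R).
Local Notation ey := (e_y R).

Lemma conjc_i : conjc 'i%C = - 'i%C :> R[i].
Proof. by rewrite -[RHS]/(_ +i* _) oppr0. Qed.

Lemma csmooth_ext Omega f g : open Omega -> (forall p, Omega p -> f p = g p) ->
  csmooth Omega f -> csmooth Omega g.
Proof.
by move=> oO fg [rf jf]; split; [apply: smooth_ext rf | apply: smooth_ext jf]
  => // p /fg ->.
Qed.

Lemma csmooth_cst Omega (c : R[i]) : open Omega -> csmooth Omega (fun=> c).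
Proof. by move=> oO; split; exact: smooth_cst. Qed.

Lemma csmooth_real Omega (f : R * R -> R) : open Omega -> smooth Omega f ->
  csmooth Omega (fun p => (f p)%:C).
Proof. by move=> oO sf; split=> //; exact: smooth_cst. Qed.

Lemma csmooth_conj Omega g : open Omega -> csmooth Omega g ->
  csmooth Omega (fun p => conjc (g p)).
Proof.
move=> oO [rg jg]; split.
- by apply: smooth_ext rg => // p _; case: (g p).
- by apply: smooth_ext (smoothN oO jg) => // p _; case: (g p).
Qed.

Lemma csmoothD Omega f g : open Omega -> csmooth Omega f -> csmooth Omega g ->
  csmooth Omega (fun p => f p + g p).
Proof.
move=> oO [rf jf] [rg jg]; split.
- by apply: smooth_ext (smoothD oO rf rg) => // p _; case: (f p) (g p) => ? ? [].
- by apply: smooth_ext (smoothD oO jf jg) => // p _; case: (f p) (g p) => ? ? [].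
Qed.

Lemma csmoothM Omega f g : open Omega -> csmooth Omega f -> csmooth Omega g ->
  csmooth Omega (fun p => f p * g p).
Proof.
move=> oO [rf jf] [rg jg]; split.
- apply: smooth_ext
    (smoothD oO (smoothM oO rf rg) (smoothN oO (smoothM oO jf jg))) => // p _.
  by case: (f p) (g p) => ? ? [].
- apply: smooth_ext
    (smoothD oO (smoothM oO rf jg) (smoothM oO jf rg)) => // p _.
  by case: (f p) (g p) => ? ? [].
Qed.

Lemma csmoothN Omega f : open Omega -> csmooth Omega f ->
  csmooth Omega (fun p => - f p).
Proof.
move=> oO sf; apply: csmooth_ext (csmoothM oO (csmooth_cst (-1) oO) sf) => //.
by move=> p _; rewrite mulN1r.
Qed.

Lemma csmooth_derivable Omega g p v : csmooth Omega g -> Omega p ->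
  v = ex \/ v = ey -> derivable (Re \o g) p v /\ derivable (Im \o g) p v.
Proof.
move=> [rg jg] Op; have [rx ry] := smooth_derivable rg Op.
have [jx jy] := smooth_derivable jg Op.
by case=> ->; [exact: (conj rx jx) | exact: (conj ry jy)].
Qed.

Lemma cderive_ext Omega f g p v :
  open Omega -> (forall q, Omega q -> f q = g q) -> Omega p -> cderive v f p = cderive v g p.
Proof.
move=> oO fg Op; rewrite /cderive; congr (_ +i* _); apply: near_eq_derive;
  by apply: filterS (open_nbhs_nbhs (conj oO Op)) => q /fg ->.
Qed.

Lemma cderiveD Omega f g p v : csmooth Omega f -> csmooth Omega g -> Omega p ->
  v = ex \/ v = ey ->
  cderive v (fun q => f q + g q) p = cderive v f p + cderive v g p.
Proof.
move=> sf sg Op hv; have [rf jf] := csmooth_derivable sf Op hv.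
have [rg jg] := csmooth_derivable sg Op hv.
transitivity ('D_v ((Re \o f) + (Re \o g)) p +i*
              'D_v ((Im \o f) + (Im \o g)) p).
  rewrite /cderive; congr ('D_v _ p +i* 'D_v _ p).
  - by apply/funext => q /=; rewrite !fctE /=; case: (f q) (g q) => ? ? [].
  - by apply/funext => q /=; rewrite !fctE /=; case: (f q) (g q) => ? ? [].
by rewrite (deriveD rf rg) (deriveD jf jg).
Qed.

Lemma cderiveM Omega f g p v : csmooth Omega f -> csmooth Omega g -> Omega p ->
  v = ex \/ v = ey ->
  cderive v (fun q => f q * g q) p = cderive v f p * g p + f p * cderive v g p.
Proof.
move=> sf sg Op hv; have [rf jf] := csmooth_derivable sf Op hv.
have [rg jg] := csmooth_derivable sg Op hv.
transitivity ('D_v ((Re \o f) * (Re \o g) - (Im \o f) * (Im \o g)) p +i*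
              'D_v ((Re \o f) * (Im \o g) + (Im \o f) * (Re \o g)) p).
  rewrite /cderive; congr ('D_v _ p +i* 'D_v _ p).
  - by apply/funext => q /=; rewrite !fctE /=; case: (f q) (g q) => ? ? [].
  - by apply/funext => q /=; rewrite !fctE /=; case: (f q) (g q) => ? ? [].
rewrite (deriveB (derivableM rf rg) (derivableM jf jg)).
rewrite (deriveD (derivableM rf jg) (derivableM jf rg)).
rewrite (deriveM rf rg) (deriveM jf jg) (deriveM rf jg) (deriveM jf rg).
rewrite /cderive /comp /=.
move: ('D_v _ p) ('D_v _ p) ('D_v _ p) ('D_v _ p) => df1 df2 dg1 dg2.
case: (f p) => a b; case: (g p) => c d /=.
have scaleE (x y : R) : x *: y = x * y by [].
rewrite !scaleE; apply/eqP; rewrite eq_complex /=.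
by apply/andP; split; apply/eqP; ring.
Qed.

Lemma cderive_conj Omega g p v : csmooth Omega g -> Omega p ->
  v = ex \/ v = ey ->
  cderive v (fun q => conjc (g q)) p = conjc (cderive v g p).
Proof.
move=> sg Op hv; have [rg jg] := csmooth_derivable sg Op hv.
rewrite /cderive /=; congr (_ +i* _).
- by congr ('D_v _ p); apply/funext => q; case: (g q).
- rewrite -(deriveN jg); congr ('D_v _ p).
  by apply/funext => q /=; rewrite !fctE /=; case: (g q).
Qed.

Lemma cderive_cst (c : R[i]) p v : cderive v (fun=> c) p = 0.
Proof. by rewrite /cderive !derive_cst. Qed.

Section Wirtinger.
Variables (Omega : set (R * R)) (oO : open Omega) (p : R * R) (Op : Omega p).

Let x_dir : ex = ex \/ ex = ey. Proof. by left. Qed.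
Let y_dir : ey = ex \/ ey = ey. Proof. by right. Qed.

Lemma del_ext f g : (forall q, Omega q -> f q = g q) -> del f p = del g p.
Proof. by move=> fg; rewrite /del !(cderive_ext _ oO fg Op). Qed.

Lemma delbar_ext f g : (forall q, Omega q -> f q = g q) ->
  delbar f p = delbar g p.
Proof. by move=> fg; rewrite /delbar !(cderive_ext _ oO fg Op). Qed.

Lemma del_cst (c : R[i]) : del (fun=> c) p = 0.
Proof. by rewrite /del !cderive_cst; ring. Qed.

Lemma delbar_cst (c : R[i]) : delbar (fun=> c) p = 0.
Proof. by rewrite /delbar !cderive_cst; ring. Qed.

Lemma delD f g : csmooth Omega f -> csmooth Omega g ->
  del (fun q => f q + g q) p = del f p + del g p.
Proof.
move=> sf sg; rewrite /del (cderiveD sf sg Op x_dir) (cderiveD sf sg Op y_dir).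
by ring.
Qed.

Lemma delbarD f g : csmooth Omega f -> csmooth Omega g ->
  delbar (fun q => f q + g q) p = delbar f p + delbar g p.
Proof.
move=> sf sg; rewrite /delbar (cderiveD sf sg Op x_dir) (cderiveD sf sg Op y_dir).
by ring.
Qed.

Lemma delM f g : csmooth Omega f -> csmooth Omega g ->
  del (fun q => f q * g q) p = del f p * g p + f p * del g p.
Proof.
move=> sf sg; rewrite /del (cderiveM sf sg Op x_dir) (cderiveM sf sg Op y_dir).
by ring.
Qed.

Lemma delbarM f g : csmooth Omega f -> csmooth Omega g ->
  delbar (fun q => f q * g q) p = delbar f p * g p + f p * delbar g p.
Proof.
move=> sf sg; rewrite /delbar (cderiveM sf sg Op x_dir) (cderiveM sf sg Op y_dir).
by ring.
Qed.

Lemma delZ (c : R[i]) f : csmooth Omega f ->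
  del (fun q => c * f q) p = c * del f p.
Proof.
by move=> sf; rewrite (delM (csmooth_cst c oO) sf) del_cst mul0r add0r.
Qed.

Lemma delbarZ (c : R[i]) f : csmooth Omega f ->
  delbar (fun q => c * f q) p = c * delbar f p.
Proof.
by move=> sf; rewrite (delbarM (csmooth_cst c oO) sf) delbar_cst mul0r add0r.
Qed.

Lemma del_conj f : csmooth Omega f ->
  del (fun q => conjc (f q)) p = conjc (delbar f p).
Proof.
move=> sf; rewrite /del /delbar (cderive_conj sf Op x_dir).
rewrite (cderive_conj sf Op y_dir).
by rewrite -mulNr -conjc_i rmorphM rmorphD rmorphM fmorphV rmorph_nat.
Qed.

Lemma delbar_conj f : csmooth Omega f ->
  delbar (fun q => conjc (f q)) p = conjc (del f p).
Proof.
move=> sf; rewrite -[LHS]conjcK -(del_conj (csmooth_conj oO sf)).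
by under [in LHS]eq_fun do rewrite conjcK.
Qed.

End Wirtinger.
End ComplexCalculus.

(** * Paths made of segments *)

Section Segments.
Variable R : realType.
Implicit Types (Omega : set (R * R)) (p q w : R * R) (t : R).
Local Notation mu := (@lebesgue_measure R).

Definition segment p w t : R * R := p + t *: w.

Lemma segment0 p w : segment p w 0 = p.
Proof. by rewrite /segment scale0r addr0. Qed.

Lemma segment1 p w : segment p w 1 = p + w.
Proof. by rewrite /segment scale1r. Qed.

Lemma is_derive_affine (a b t : R) : is_derive t 1 (fun s : R => a + s * b) b.
Proof.
have -> : (fun s : R => a + s * b) = cst a + (id : R -> R) * cst b by [].
by apply: is_derive_eq; rewrite /GRing.scale/=; ring.
Qed.

Lemma derive_segment p w :
  derive1 (fun s => (segment p w s).1) = cst w.1 /\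
  derive1 (fun s => (segment p w s).2) = cst w.2.
Proof.
by split; apply/funext => t; rewrite derive1E;
  [case: (is_derive_affine p.1 w.1 t) | case: (is_derive_affine p.2 w.2 t)].
Qed.

Lemma segment_C1 p w : C1_arc (segment p w).
Proof.
have [d1 d2] := derive_segment p w; split.
- by move=> t; case: (is_derive_affine p.1 w.1 t).
- by move=> t; case: (is_derive_affine p.2 w.2 t).
- by rewrite d1 => t; exact: cvg_cst.
- by rewrite d2 => t; exact: cvg_cst.
Qed.

Lemma velocity_segment p w t : velocity (segment p w) t = w.1 +i* w.2.
Proof. by have [d1 d2] := derive_segment p w; rewrite /velocity d1 d2. Qed.

Lemma continuous_segment p w : continuous (segment p w).
Proof.
move=> t; apply: cvgD; first exact: cvg_cst.
by apply: cvgZr_tmp; exact: cvg_id.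
Qed.

Lemma segment_ball p w (e : R) t : `|w.1| < e -> `|w.2| < e -> t \in `[0, 1] ->
  ball p e (segment p w t).
Proof.
move=> w1 w2; rewrite in_itv /= => /andP[t0 t1].
have H (a b : R) : `|b| < e -> ball a e (a + t * b).
  move=> be; rewrite -ball_normE /= opprD addrA subrr add0r normrN normrM.
  rewrite (ger0_norm t0); apply: le_lt_trans be.
  by rewrite ler_piMl.
by split; exact: H.
Qed.

Lemma ball_diff p q (e : R) : ball p e q ->
  `|(q - p).1| < e /\ `|(q - p).2| < e.
Proof.
by case; rewrite -!ball_normE /= => b1 b2; split; rewrite -normrN opprB.
Qed.

Lemma is_path_cat Omega p q r a b :
  is_path Omega p q a -> is_path Omega q r b -> is_path Omega p r (a ++ b).
Proof.
elim: a p => [|g a IH] p /=; first by move->.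
by move=> [? ? ? pa] pb; split=> //; exact: IH.
Qed.

Lemma is_path_segment Omega p w :
  (forall t, t \in `[0, 1] -> Omega (segment p w t)) ->
  is_path Omega p (p + w) [:: segment p w].
Proof.
by move=> H; split=> //; [exact: segment_C1|exact: segment0|exact: segment1].
Qed.

Lemma segment_rev p q t : segment q (p - q) t = segment p (q - p) (1 - t).
Proof.
by rewrite /segment scalerBl scale1r addrA subrKC -[p - q]opprB scalerN.
Qed.

(** The points reachable from [p] form a set which is open, and whose complement
    in [Omega] is open as well: in a small ball the segment from the centre to any
    other point, traversed either way, stays in the ball. *)
Lemma path_connected Omega p q : open Omega -> connected Omega ->
  Omega p -> Omega q -> exists arcs, is_path Omega p q arcs.
Proof.
move=> oO cO Op Oq.
pose A := [set r | Omega r /\ exists arcs, is_path Omega p r arcs].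
suff AO : A = Omega by have [] : A q by rewrite AO.
have ballO r : Omega r -> exists2 e : R, 0 < e & ball r e `<=` Omega.
  by move=> Or; have /nbhs_ballP[e e0 be] := open_nbhs_nbhs (conj oO Or); exists e.
have seg r s (e : R) : ball r e `<=` Omega -> ball r e s ->
    forall t, t \in `[0, 1] -> Omega (segment r (s - r) t).
  by move=> be /ball_diff[? ?] t t01; apply: be; exact: segment_ball.
have oA : open A.
  rewrite openE => r [Or [arcs pr]]; have [e e0 be] := ballO r Or.
  apply/nbhs_ballP; exists e => // s bs; split; first exact: be.
  exists (arcs ++ [:: segment r (s - r)]); apply: is_path_cat pr _.
  by have := is_path_segment (seg r s e be bs); rewrite subrKC.
have oOA : open (Omega `\` A).
  rewrite openE => r [Or nAr]; have [e e0 be] := ballO r Or.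
  apply/nbhs_ballP; exists e => // s bs; split; first exact: be.
  move=> [Os [arcs ps]]; apply: nAr; split=> //.
  exists (arcs ++ [:: segment s (r - s)]); apply: is_path_cat ps _.
  have sr : forall t, t \in `[0, 1] -> Omega (segment s (r - s) t).
    move=> t; rewrite in_itv /= => /andP[t0 t1].
    rewrite segment_rev; apply: (seg r s e be bs).
    by rewrite in_itv /= subr_ge0 t1 gerBl.
  by have := is_path_segment sr; rewrite subrKC.
apply: cO.
- by exists p; split=> //; exists [::].
- by exists A => //; apply/seteqP; split=> [r [Or ?]|r []].
- exists (~` (Omega `\` A)); first exact: open_closedC.
  apply/seteqP; split=> [r Ar|r [Or /=]].
    by split; [case: Ar | case].
  by move/not_andP => -[//|/contrapT].
Qed.

End Segments.

(** * Primitives of differential forms *)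

Section FundamentalTheorem.
Variable R : realType.
Implicit Types (Omega : set (R * R)) (p q w : R * R) (t : R).
Local Notation mu := (@lebesgue_measure R).

Lemma Rintegral01_dist (h : R -> R) (c e : R) :
  {within `[0, 1], continuous h} ->
  (forall t, t \in `[0, 1] -> `|h t - c| <= e) ->
  `|\int[mu]_(t in `[0, 1]) h t - c| <= e.
Proof.
move=> ch hc.
have m01 : measurable (`[0, 1] : set R) by exact: measurable_itv.
have cst_int (k : R) : \int[mu]_(t in `[0, 1]) k = k.
  by rewrite Rintegral_cst //= lebesgue_measure_itv /= lte_fin ltr01 sube0 mulr1.
have cst_integrable (k : R) : mu.-integrable `[0, 1] (EFin \o (fun=> k)).
  apply: continuous_compact_integrable; first exact: segment_compact.
  by apply: continuous_subspaceT => x; exact: cvg_cst.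
have h_integrable : mu.-integrable `[0, 1] (EFin \o h).
  by apply: continuous_compact_integrable => //; exact: segment_compact.
rewrite ler_distl; apply/andP; split.
- rewrite -[leLHS]cst_int; apply: le_Rintegral => // t t01.
  by have := hc t t01; rewrite ler_distl => /andP[].
- rewrite -[leRHS]cst_int; apply: le_Rintegral => // t t01.
  by have := hc t t01; rewrite ler_distl => /andP[].
Qed.

Section Increments.
Variables (Omega : set (R * R)) (f F1 F2 : R * R -> R) (p : R * R).
Hypotheses (oO : open Omega) (Op : Omega p).
Hypotheses (cF1 : forall q, Omega q -> {for q, continuous F1})
           (cF2 : forall q, Omega q -> {for q, continuous F2}).
Hypothesis increment : forall w,
  (forall t, t \in `[0, 1] -> Omega (segment p w t)) ->
  f (p + w) - f p = \int[mu]_(t in `[0, 1])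
    (F1 (segment p w t) * w.1 + F2 (segment p w t) * w.2).

(** This is differentiability of [f] at [p] with gradient [(F1, F2)]: along a
    short segment from [p] the integrand differs little from its value at [p].
    Both continuity and the partial derivatives of [f] come from this estimate. *)
Lemma increment_estimate (e : R) : 0 < e -> exists2 d : R, 0 < d &
  forall w, `|w.1| < d -> `|w.2| < d ->
  `|f (p + w) - f p - (F1 p * w.1 + F2 p * w.2)| <= e * (`|w.1| + `|w.2|).
Proof.
move=> e0.
have close (F : R * R -> R) : {for p, continuous F} ->
    \forall q \near p, `|F q - F p| <= e.
  move=> cF; have /cvgrPdist_le /(_ e e0) := cF.
  by apply: filterS => q; rewrite distrC.
have : \forall q \near p, [/\ Omega q, `|F1 q - F1 p| <= e & `|F2 q - F2 p| <= e].
  have A1 := open_nbhs_nbhs (conj oO Op).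
  have A2 := close F1 (cF1 Op); have A3 := close F2 (cF2 Op).
  by apply: filterS3 A1 A2 A3 => q; split.
move=> /nbhs_ballP[d d0 bd]; exists d => // w w1 w2.
have segO t : t \in `[0, 1] -> Omega (segment p w t).
  by move=> t01; have [] := bd _ (segment_ball p w1 w2 t01).
rewrite increment//; apply: Rintegral01_dist.
  apply: continuous_in_subspaceT => t; rewrite inE /= => t01.
  have Oq := segO t t01.
  have comp (F : R * R -> R) : {for segment p w t, continuous F} ->
      {for t, continuous (fun s => F (segment p w s))}.
    by move=> cF; apply: continuous_comp cF; exact: continuous_segment.
  apply: cvgD; (apply: cvgM; last exact: cvg_cst).
    exact: comp _ (cF1 Oq).
  exact: comp _ (cF2 Oq).
move=> t t01; have [_ b1 b2] := bd _ (segment_ball p w1 w2 t01).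
rewrite opprD addrACA -!mulrBl mulrDr; apply: le_trans (ler_normD _ _) _.
by apply: lerD; rewrite normrM; exact: ler_wpM2r.
Qed.

Lemma continuous_of_increment : {for p, continuous f}.
Proof.
apply/cvgrPdist_le => e e0; have [d d0 est] := increment_estimate ltr01.
(* For small w, increment_estimate with e = 1 bounds the increment of f by
   |w.1| + |w.2| + |F1 p| |w.1| + |F2 p| |w.2|, that is by M max(|w.1|, |w.2|). *)
pose M := `|F1 p| + `|F2 p| + 2.
have M0 : 0 < M by rewrite /M ltr_wpDl// addr_ge0.
have near_p : \forall q \near p, ball p (Num.min d (e / M)) q.
  apply: nbhsx_ballx.
  by rewrite lt_min d0 divr_gt0.
apply: filterS near_p => q /ball_diff[].
rewrite !lt_min => /andP[w1 w1'] /andP[w2 w2'].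
have := est (q - p) w1 w2; rewrite subrKC => H; rewrite distrC.
set w := q - p in w1 w2 w1' w2' H *.
rewrite -[f q - f p](subrK (F1 p * w.1 + F2 p * w.2)).
apply: le_trans (ler_normD _ _) _; apply: le_trans (lerD H (ler_normD _ _)) _.
rewrite !normrM.
have eM : e = M * (e / M) by rewrite mulrC divfK// gt_eqF.
rewrite [leRHS]eM /M mulrDl mulrDl mul1r addrC.
apply: lerD; first by apply: lerD; apply: ler_wpM2l => //; exact: ltW.
by rewrite mulr_natl mulr2n; apply: lerD; exact: ltW.
Qed.

Lemma is_derive_of_increment (v : R * R) : v = e_x R \/ v = e_y R ->
  is_derive p v f (F1 p * v.1 + F2 p * v.2).
Proof.
move=> hv.
have lim : h^-1 *: ((f \o shift p) (h *: v) - f p) @[h --> 0^'] -->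
    F1 p * v.1 + F2 p * v.2.
  apply/cvgrPdist_le => e e0; have [d d0 est] := increment_estimate e0.
  have nv : `|v.1| + `|v.2| = 1.
    by case: hv => -> /=; rewrite normr0 normr1 ?addr0 ?add0r.
  near=> h.
  have h0 : h != 0 by near: h; exact: nbhs_dnbhs_neq.
  have hd : `|h| < d by near: h; apply: dnbhs0_lt.
  have := est (h *: v).
  rewrite /= !normrM.
  have n1 : `|v.1| <= 1 by rewrite -nv lerDl.
  have n2 : `|v.2| <= 1 by rewrite -nv lerDr.
  have hv1 : `|h| * `|v.1| < d by apply: le_lt_trans hd; rewrite ler_piMr.
  have hv2 : `|h| * `|v.2| < d by apply: le_lt_trans hd; rewrite ler_piMr.
  move=> /(_ hv1 hv2); rewrite -mulrDr nv mulr1 => H.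
  rewrite distrC /shift /= [h *: v + p]addrC.
  have -> : F1 p * v.1 + F2 p * v.2 =
      h^-1 * (F1 p * (h * v.1) + F2 p * (h * v.2)) by field.
  rewrite -[h^-1 *: _]/(h^-1 * _) -mulrBr normrM normfV mulrC.
  by rewrite ler_pdivrMr ?normr_gt0.
by apply: DeriveDef; [apply/cvg_ex; eexists; exact: lim | exact/cvg_lim].
Unshelve. all: by end_near. Qed.

End Increments.
End FundamentalTheorem.

Section Primitives.
Variable R : realType.
Implicit Types (Omega : set (R * R)) (p q w : R * R) (t : R).
Local Notation mu := (@lebesgue_measure R).
Local Notation Re := (@complex.Re R).
Local Notation Im := (@complex.Im R).

Lemma smooth_primitive Omega (f F1 F2 : R * R -> R) : open Omega ->
  smooth Omega F1 -> smooth Omega F2 ->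
  (forall p w, Omega p ->
     (forall t, t \in `[0, 1] -> Omega (segment p w t)) ->
     f (p + w) - f p = \int[mu]_(t in `[0, 1])
       (F1 (segment p w t) * w.1 + F2 (segment p w t) * w.2)) ->
  smooth Omega f /\ forall p, Omega p ->
    'D_(e_x R) f p = F1 p /\ 'D_(e_y R) f p = F2 p.
Proof.
move=> oO sF1 sF2 incr.
have cF1 q (Oq : Omega q) := smooth_continuous sF1 Oq.
have cF2 q (Oq : Omega q) := smooth_continuous sF2 Oq.
have dx p : Omega p -> is_derive p (e_x R) f (F1 p).
  move=> Op; have := is_derive_of_increment oO Op cF1 cF2
    (fun w => @incr p w Op) (or_introl erefl).
  by rewrite /= mulr1 mulr0 addr0.
have dy p : Omega p -> is_derive p (e_y R) f (F2 p).
  move=> Op; have := is_derive_of_increment oO Op cF1 cF2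
    (fun w => @incr p w Op) (or_intror erefl).
  by rewrite /= mulr1 mulr0 add0r.
split; last by move=> p Op; case: (dx p Op) (dy p Op) => _ -> [_ ->].
apply: (smooth_of_partials oO _ sF1 sF2) => p Op.
have cf := continuous_of_increment oO Op cF1 cF2 (fun w => @incr p w Op).
exact: (And3 cf (dx p Op) (dy p Op)).
Qed.

(** If [df = a dz + b dzbar], then the [x]- and [y]-derivatives of [f] are
    [a + b] and [i (a - b)], because [dz = dx + i dy]; hence [a] and [b] are the
    Wirtinger derivatives. *)
Lemma complex_primitive Omega (f a b : R * R -> R[i]) : open Omega ->
  csmooth Omega a -> csmooth Omega b ->
  (forall p w, Omega p ->
     (forall t, t \in `[0, 1] -> Omega (segment p w t)) ->
     f (p + w) - f p = cintegral01 (fun t =>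
       a (segment p w t) * velocity (segment p w) t +
       b (segment p w t) * conjc (velocity (segment p w) t))) ->
  csmooth Omega f /\ forall p, Omega p -> del f p = a p /\ delbar f p = b p.
Proof.
move=> oO sa sb incr.
have [rs js] := csmoothD oO sa sb.
have [rd jd] := csmoothD oO sa (csmoothN oO sb).
have [|sr dr] := smooth_primitive (f := fun p => Re (f p)) oO rs (smoothN oO jd).
  move=> p w Op sO; have /(congr1 Re) := incr p w Op sO.
  have -> : Re (f (p + w) - f p) = Re (f (p + w)) - Re (f p).
    by case: (f _) (f _) => ? ? [].
  move->; apply: eq_Rintegral => t _; rewrite velocity_segment.
  by case: (a _) (b _) => ? ? [? ?] /=; ring.
have [|sj dj] := smooth_primitive (f := fun p => Im (f p)) oO js rd.
  move=> p w Op sO; have /(congr1 Im) := incr p w Op sO.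
  have -> : Im (f (p + w) - f p) = Im (f (p + w)) - Im (f p).
    by case: (f _) (f _) => ? ? [].
  move->; apply: eq_Rintegral => t _; rewrite velocity_segment.
  by case: (a _) (b _) => ? ? [? ?] /=; ring.
split=> [|p Op]; first exact: (conj sr sj).
have [drx dry] := dr p Op; have [djx djy] := dj p Op.
have Dx : cderive (e_x R) f p = a p + b p.
  by rewrite /cderive drx djx; case: (a p) (b p) => ? ? [].
have Dy : cderive (e_y R) f p = 'i%C * (a p - b p).
  rewrite /cderive dry djy; case: (a p) (b p) => a1 a2 [b1 b2] /=.
  by apply/eqP; rewrite eq_complex /=; apply/andP; split; apply/eqP; ring.
rewrite /del /delbar Dx Dy mulrA -expr2 sqr_i mulN1r opprK opprB.
split.
  by rewrite addrACA subrr addr0 -mulr2n -[X in _ * X]mulr_natl mulKf ?pnatr_eq0.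
by rewrite addrC subrKA -mulr2n -[X in _ * X]mulr_natl mulKf ?pnatr_eq0.
Qed.

End Primitives.

(** * Derivatives of the Weierstrass surface *)

Section Surface.
Variable R : realType.
Implicit Types (Omega : set (R * R)) (p q w : R * R) (t : R).
Local Notation C := R[i].

Lemma mat2E (a b c d : C) :
  ((mat2 a b c d 0 0 = a) * (mat2 a b c d 0 1 = b) *
   (mat2 a b c d 1 0 = c) * (mat2 a b c d 1 1 = d))%type.
Proof. by rewrite !mxE. Qed.

(** A path from [P0] to [p] prolonged by a segment is again a path, so the
    increment of the surface along the segment is a single integral. *)
Lemma surface_increment Omega P0 (psi : R * R -> 'cV[C]_2) S p w i j :
  open Omega -> connected Omega -> Omega P0 ->
  weierstrass_surface Omega P0 psi S -> Omega p ->
  (forall t, t \in `[0, 1] -> Omega (segment p w t)) ->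
  su2 (S (p + w)) i j - su2 (S p) i j = 'i%C * cintegral01 (fun t =>
     form_dz psi (segment p w t) i j * velocity (segment p w) t +
     form_dzbar psi (segment p w t) i j * conjc (velocity (segment p w) t)).
Proof.
move=> oO cO OP0 hS Op sO.
have [arcs pa] := path_connected oO cO OP0 Op.
rewrite (hS _ _ (is_path_cat pa (is_path_segment sO))) (hS _ _ pa).
rewrite /path_integral big_cat big_seq1 !mxE.
by rewrite mulrDr addrA [X in X - _ = _]addrC addrK.
Qed.

(** The complex coordinate [x1 - i x2] is the lower left entry of [su2 x];
    together with [x3] it determines [x], and in these coordinates the
    Weierstrass equations become monomial. *)
Definition xminus (x : 'rV[R]_3) : C := (x 0 0)%:C - 'i%C * (x 0 1)%:C.

Lemma surface_derivatives Omega P0 U (psi : R * R -> 'cV[C]_2) S :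
  open Omega -> connected Omega -> Omega P0 ->
  dirac_solution Omega U psi -> weierstrass_surface Omega P0 psi S ->
  [/\ csmooth Omega (fun p => (S p 0 2)%:C),
      csmooth Omega (fun p => xminus (S p)) &
      forall p, Omega p ->
      [/\ del (fun q => (S q 0 2)%:C) p = comp1 psi p * conjc (comp2 psi p),
          del (fun q => xminus (S q)) p = 'i%C * comp1 psi p ^+ 2 &
          delbar (fun q => xminus (S q)) p = - ('i%C * comp2 psi p ^+ 2)]].
Proof.
move=> oO cO OP0 [s1 s2 _] hS.
have c1 := csmooth_conj oO s1; have c2 := csmooth_conj oO s2.
have i0 : ('i%C : C) != 0 by rewrite eq_complex /= oner_eq0 andbF.
have ii : - 'i%C * 'i%C = 1 :> C by rewrite mulNr -expr2 sqr_i opprK.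
(* The entries of su2 (S p) are i times the integrals of the forms: (0, 0) gives
   x3 and (1, 0) gives - i (x1 - i x2) as primitives. *)
have [|s3 d3] := complex_primitive (f := fun p => (S p 0 2)%:C) oO
    (csmoothM oO s1 c2) (csmoothM oO c1 s2).
  move=> p w Op sO; apply: (mulfI i0).
  have := surface_increment 0 0 oO cO OP0 hS Op sO.
  rewrite /su2 /form_dz /form_dzbar !mat2E -mulrBr => ->.
  by congr (_ * cintegral01 _); apply/funext => t; rewrite !mat2E.
have [|sm dm] := complex_primitive (f := fun p => - 'i%C * xminus (S p)) oO
    (csmoothM oO s1 s1) (csmoothN oO (csmoothM oO s2 s2)).
  move=> p w Op sO; apply: (mulfI i0).
  have := surface_increment 1 0 oO cO OP0 hS Op sO.
  rewrite /su2 !mat2E -!/(xminus _) -mulrBr mulrA mulrN -mulNr ii mul1r => ->.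
  by congr (_ * cintegral01 _); apply/funext => t; rewrite !mat2E !expr2.
have sX : csmooth Omega (fun p => xminus (S p)).
  apply: csmooth_ext (csmoothM oO (csmooth_cst 'i%C oO) sm) => // p _.
  by rewrite mulrA mulrN -mulNr ii mul1r.
split=> // p Op; have [dd3 _] := d3 p Op; have [ddm ddmb] := dm p Op.
split=> //.
- by rewrite expr2 -ddm (delZ oO Op _ sX) mulrA mulrN -mulNr ii mul1r.
- rewrite expr2 -[X in _ = X]mulrN -ddmb (delbarZ oO Op _ sX) mulrA mulrN -mulNr ii.
  by rewrite mul1r.
Qed.

End Surface.

(** * Uniqueness of the potential *)

Section PotentialUniqueness.
Variable R : realType.
Local Notation C := R[i].
Implicit Types (Omega : set (R * R)) (psi : R * R -> 'cV[C]_2).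

Lemma spinor_eq0 (v : 'cV[C]_2) : (v == 0) = (v 0 0 == 0) && (v 1 0 == 0).
Proof.
apply/eqP/andP => [->|[/eqP v0 /eqP v1]]; first by rewrite !mxE.
by apply/matrixP => i j; rewrite ord1 mxE; case: i => [[|[|//]] ?];
  [rewrite -[RHS]v0 | rewrite -[RHS]v1]; congr (v _ _); apply/val_inj.
Qed.

Lemma dirac_eq0 U psi p : Defs.dirac U psi p = 0 <->
  del (comp2 psi) p = - ((U p)%:C * comp1 psi p) /\
  delbar (comp1 psi) p = (U p)%:C * comp2 psi p.
Proof.
have E : Defs.dirac U psi p = col2 (del (comp2 psi) p + (U p)%:C * comp1 psi p)
                              (- delbar (comp1 psi) p + (U p)%:C * comp2 psi p).
  apply/matrixP => i j; rewrite ord1 /Defs.dirac /mat2 /col2 /comp1 /comp2.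
  rewrite !mxE !big_ord_recl big_ord0 !mxE /=.
  case: i => [[|[|//]] ?] /=; rewrite !mul0r ?addr0 ?add0r; congr (_ + _ * _);
  by congr (psi p _ _); apply/val_inj.
rewrite E; split=> [/eqP|[-> ->]].
  rewrite spinor_eq0 !mxE /= addr_eq0 => /andP[/eqP-> ]; split=> //.
  by apply/eqP; rewrite eq_sym -subr_eq0 addrC.
by apply/eqP; rewrite spinor_eq0 !mxE /= !addNr eqxx.
Qed.

Lemma weierstrass_squares Omega psi r p : weierstrass_equations Omega psi r ->
  Omega p ->
  [/\ comp1 psi p ^+ 2 = - (del (fun q => (Defs.coord r 1 q)%:C) p +
                            'i%C * del (fun q => (Defs.coord r 0 q)%:C) p),
      conjc (comp2 psi p) ^+ 2 = del (fun q => (Defs.coord r 1 q)%:C) p -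
                                 'i%C * del (fun q => (Defs.coord r 0 q)%:C) p &
      comp1 psi p * conjc (comp2 psi p) = del (fun q => (Defs.coord r 2 q)%:C) p].
Proof.
move=> w Op; have [-> -> ->] := w p Op.
have ii : 'i%C * 'i%C = -1 :> C by rewrite -expr2 sqr_i.
by split=> //; field: ii.
Qed.

Lemma conjc_oppM (u : R) (z : C) :
  conjc (- (u%:C * z)) = - (u%:C * conjc z).
Proof. by rewrite rmorphN rmorphM; congr (- (_ * _)); exact: conjc_real. Qed.

(** The first three equations say that [(f1, f2)] and [(c1, c2)] agree up to sign
    in each component, the two signs being equal unless [c1 c2 = 0].  So
    [f1 f2 = c1 c2], [|f1| = |c1|] and [|f2| = |c2|], and the remaining
    equations reduce to [(v - u) c1 c2 = 0] and
    [(v - u) (|c2|^2 - |c1|^2) = 0]. *)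
Lemma spinor_pair_eq0 (c1 c2 f1 f2 u v : C) :
  f1 ^+ 2 = c1 ^+ 2 -> f2 ^+ 2 = c2 ^+ 2 -> f1 * conjc f2 = c1 * conjc c2 ->
  v * f2 * f1 + f1 * (v * f2) = u * c2 * c1 + c1 * (u * c2) ->
  v * f2 * conjc f2 + f1 * - (v * conjc f1) =
    u * c2 * conjc c2 + c1 * - (u * conjc c1) ->
  v != u -> (c1 == 0) && (c2 == 0).
Proof.
move=> q1 q2 pr E1 E2 vu.
have dvu : v - u != 0 by rewrite subr_eq0.
have n2 : f2 * conjc f2 = c2 * conjc c2.
  by move/eqP: q2; rewrite eqf_sqr => /orP[] /eqP ->; rewrite ?rmorphN ?mulrNN.
have n1 : f1 * conjc f1 = c1 * conjc c1.
  by move/eqP: q1; rewrite eqf_sqr => /orP[] /eqP ->; rewrite ?rmorphN ?mulrNN.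
have zero_or (z w : C) : - (z * conjc w) = z * conjc w -> z * w = 0.
  move/eqP; rewrite eqNr mulf_eq0 conjc_eq0 => /orP[] /eqP ->.
    by rewrite mul0r.
  by rewrite mulr0.
have f12 : f1 * f2 = c1 * c2.
  move: q1 q2 pr => /eqP + /eqP; rewrite !eqf_sqr.
  move=> /orP[] /eqP -> /orP[] /eqP -> //; rewrite ?rmorphN ?mulrNN //.
  - by rewrite !mulrN => e; rewrite (zero_or c1 c2) ?oppr0.
  - by rewrite !mulNr => e; rewrite (zero_or c1 c2) ?oppr0.
have c12 : c1 * c2 = 0.
  have : 2 * (v - u) * (c1 * c2) = 0.
    have -> : 2 * (v - u) * (c1 * c2) = (v * f2 * f1 + f1 * (v * f2)) -
        (u * c2 * c1 + c1 * (u * c2)) by ring: f12.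
    by rewrite E1 subrr.
  by move/eqP; rewrite !mulf_eq0 pnatr_eq0 (negPf dvu) -mulf_eq0 => /eqP.
have : (v - u) * (c2 * conjc c2 - c1 * conjc c1) = 0.
  have -> : (v - u) * (c2 * conjc c2 - c1 * conjc c1) =
      (v * f2 * conjc f2 + f1 * - (v * conjc f1)) -
      (u * c2 * conjc c2 + c1 * - (u * conjc c1)) by ring: n1 n2.
  by rewrite E2 subrr.
move/eqP; rewrite mulf_eq0 (negPf dvu) subr_eq0 /=.
move/eqP: c12; rewrite mulf_eq0 => /orP[] /eqP ->; rewrite ?eqxx /= ?andbT.
  by rewrite mul0r mulf_eq0 conjc_eq0 orbb.
by rewrite mul0r eq_sym mulf_eq0 conjc_eq0 orbb.
Qed.

(** The Weierstrass equations of a spinor [psi] recover [psi1 ^ 2],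
    [conj psi2 ^ 2] and [psi1 conj psi2] from the surface.  Applying [delbar] to
    the first and the third, the Dirac equation turns them into
    [2 U psi1 psi2] and [U (|psi2|^2 - |psi1|^2)]; these two quantities are thus
    common to all potentials, and they determine [U] where [psi] does not
    vanish. *)
Lemma potential_unique Omega r U V : open Omega ->
  has_weierstrass_potential Omega r U -> has_weierstrass_potential Omega r V ->
  forall p, Omega p -> V p = U p.
Proof.
move=> oO [_ _ [chi [[sc1 sc2 dc] nc wc]]] [_ _ [phi [[sf1 sf2 df] _ wf]]] p Op.
have sq1 q : Omega q -> comp1 phi q * comp1 phi q = comp1 chi q * comp1 chi q.
  move=> Oq; have [e _ _] := weierstrass_squares wc Oq.
  by have [e' _ _] := weierstrass_squares wf Oq; rewrite -!expr2 e e'.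
have sq2 : comp2 phi p ^+ 2 = comp2 chi p ^+ 2.
  have [_ e _] := weierstrass_squares wc Op.
  have [_ e' _] := weierstrass_squares wf Op.
  by apply: (can_inj (@conjcK R)); rewrite !rmorphXn /= e e'.
have pr q : Omega q -> comp1 phi q * conjc (comp2 phi q) =
                       comp1 chi q * conjc (comp2 chi q).
  move=> Oq; have [_ _ e] := weierstrass_squares wc Oq.
  by have [_ _ e'] := weierstrass_squares wf Oq; rewrite e e'.
have [dc2 dc1] := (dirac_eq0 U chi p).1 (dc p Op).
have [df2 df1] := (dirac_eq0 V phi p).1 (df p Op).
have := delbar_ext oO Op sq1.
rewrite (delbarM Op sf1 sf1) (delbarM Op sc1 sc1) dc1 df1 => E1.
have := delbar_ext oO Op pr.
rewrite (delbarM Op sf1 (csmooth_conj oO sf2)).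
rewrite (delbarM Op sc1 (csmooth_conj oO sc2)).
rewrite (delbar_conj oO Op sf2) (delbar_conj oO Op sc2) dc1 df1 dc2 df2.
rewrite !conjc_oppM => E2.
have := nc p Op; rewrite spinor_eq0.
apply/contraNeq => VU; apply: (spinor_pair_eq0 _ sq2 (pr p Op) E1 E2).
  by rewrite expr2 sq1.
by apply: contraNneq VU => /complexI ->.
Qed.

End PotentialUniqueness.

(** * Inversion in su(2) *)

Section Inversion.
Variable R : realType.
Local Notation C := R[i].
Implicit Types (Omega : set (R * R)) (psi : R * R -> 'cV[C]_2)
  (S : R * R -> 'rV[R]_3) (x : 'rV[R]_3).

Let ii : 'i%C * 'i%C = -1 :> C. Proof. by rewrite -expr2 sqr_i. Qed.

Definition norm2 x : R := \sum_k x 0 k ^+ 2.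

Lemma norm2E x : norm2 x = x 0 0 ^+ 2 + x 0 1 ^+ 2 + x 0 2 ^+ 2.
Proof.
rewrite /norm2 !big_ord_recl big_ord0 addr0 addrA.
by congr (x 0 _ ^+ 2 + x 0 _ ^+ 2 + x 0 _ ^+ 2); apply/val_inj.
Qed.

Lemma norm2_eq0 x : (norm2 x == 0) = (x == 0).
Proof.
apply/eqP/eqP => [n0|->].
  apply/matrixP => i j; rewrite ord1 mxE; apply/eqP; rewrite -sqrf_eq0.
  have /eqP := n0; rewrite psumr_eq0 => [/allP/(_ j (mem_index_enum _))//|k _].
  exact: sqr_ge0.
by rewrite /norm2 big1 // => k _; rewrite mxE expr0n.
Qed.

Lemma Re_xminus x : complex.Re (xminus x) = x 0 0.
Proof. by rewrite /xminus /=; ring. Qed.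

Lemma Im_xminus x : complex.Im (xminus x) = - x 0 1.
Proof. by rewrite /xminus /=; ring. Qed.

Lemma conj_xminus x : conjc (xminus x) = (x 0 0)%:C + 'i%C * (x 0 1)%:C.
Proof.
by apply/eqP; rewrite eq_complex /=; apply/andP; split; apply/eqP; ring.
Qed.

Lemma norm2_xminus x :
  (norm2 x)%:C = xminus x * conjc (xminus x) + (x 0 2)%:C * (x 0 2)%:C.
Proof.
by rewrite conj_xminus norm2E; apply/eqP; rewrite eq_complex /=; apply/andP;
  split; apply/eqP; ring.
Qed.

Lemma inversionE x k : inversion x 0 k = - ((norm2 x)^-1 * x 0 k).
Proof. by rewrite /inversion mxE mulNr. Qed.

Lemma inversion_x3 x :
  (inversion x 0 2)%:C = - ((norm2 x)^-1%:C * (x 0 2)%:C) :> C.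
Proof. by rewrite inversionE rmorphN rmorphM. Qed.

Lemma inversion_xminus x :
  xminus (inversion x) = - ((norm2 x)^-1%:C * xminus x).
Proof.
by rewrite /xminus !inversionE; apply/eqP; rewrite eq_complex /=; apply/andP;
  split; apply/eqP; ring.
Qed.

Lemma su2E x : su2 x = mat2 ('i%C * (x 0 2)%:C) (- conjc (xminus x))
                            (xminus x) (- ('i%C * (x 0 2)%:C)).
Proof. by rewrite /su2 conj_xminus opprD. Qed.

Lemma mat2M (a b c d a' b' c' d' : C) :
  mat2 a b c d *m mat2 a' b' c' d' =
  mat2 (a * a' + b * c') (a * b' + b * d') (c * a' + d * c') (c * b' + d * d').
Proof.
apply/matrixP => i j; rewrite !mxE !big_ord_recl big_ord0 !mxE addr0.
by case: i j => [[|[|//]] ?] [[|[|//]] ?].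
Qed.

Lemma mat2_1 : mat2 1 0 0 1 = 1%:M :> 'M[C]_2.
Proof. by apply/matrixP => [] [[|[|//]] ?] [[|[|//]] ?]; rewrite !mxE. Qed.

Lemma invmx_right (A B : 'M[C]_2) : A *m B = 1%:M -> B = invmx A.
Proof.
move=> AB; have [uA _] := mulmx1_unit AB.
by rewrite -[LHS]mul1mx -(mulVmx uA) -mulmxA AB mulmx1.
Qed.

(** The identity [|x|^-2 |x|^2 = 1], with one monomial isolated on the left so
    that [ring] can use it as a rewriting rule. *)
Lemma inv_norm2M x : norm2 x != 0 ->
  (norm2 x)^-1%:C * (xminus x * conjc (xminus x)) =
  1 - (norm2 x)^-1%:C * ((x 0 2)%:C * (x 0 2)%:C).
Proof.
move=> x0; apply/eqP; rewrite eq_sym subr_eq -mulrDr -norm2_xminus -rmorphM.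
by rewrite mulVf.
Qed.

(** Elements of su(2) satisfy [X ^ 2 = - |x|^2]. *)
Lemma su2_inversion x : x != 0 -> su2 (inversion x) = invmx (su2 x).
Proof.
rewrite -norm2_eq0 => x0; apply: invmx_right.
have nx := inv_norm2M x0.
rewrite !su2E mat2M inversion_x3 inversion_xminus conjc_oppM -mat2_1.
by congr mat2; ring: ii nx.
Qed.

(** * The spinor of the inverted surface *)

(** In matrix form [(conj chi2, chi1) = S^-1 (conj psi2, psi1)] as columns.  This
    is forced, up to sign, by the differential: [S_z] is [i] times the rank one
    matrix with column [v = (conj psi2, psi1)] and row [(psi1, - conj psi2)], and
    in [(S^-1)_z = - S^-1 S_z S^-1] both factors are transformed by [S^-1], which
    sends [v] to the corresponding column of the new surface. *)
Definition inverted_spinor psi S (p : R * R) : 'cV[C]_2 :=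
  let y := inversion (S p) in
  let psi1 := comp1 psi p in let psi2 := comp2 psi p in
  col2 (xminus y * conjc psi2 - 'i%C * (y 0 2)%:C * psi1)
       (- ('i%C * (y 0 2)%:C * psi2 + xminus y * conjc psi1)).

Lemma comp1_inverted psi S p : comp1 (inverted_spinor psi S) p =
  xminus (inversion (S p)) * conjc (comp2 psi p) -
  'i%C * (inversion (S p) 0 2)%:C * comp1 psi p.
Proof. by rewrite /comp1 /inverted_spinor mxE. Qed.

Lemma comp2_inverted psi S p : comp2 (inverted_spinor psi S) p =
  - ('i%C * (inversion (S p) 0 2)%:C * comp2 psi p +
     xminus (inversion (S p)) * conjc (comp1 psi p)).
Proof. by rewrite /comp2 /inverted_spinor mxE. Qed.

Lemma conj_comp2_inverted psi S p : conjc (comp2 (inverted_spinor psi S) p) =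
  'i%C * (inversion (S p) 0 2)%:C * conjc (comp2 psi p) -
  conjc (xminus (inversion (S p))) * comp1 psi p.
Proof.
rewrite comp2_inverted; case: (xminus _) (comp1 _ _) (comp2 _ _) => m1 m2 [a1 a2].
by move=> [b1 b2]; apply/eqP; rewrite eq_complex /=; apply/andP;
  split; apply/eqP; ring.
Qed.

(** The scalar [- i K_11], written with the old and the new spinor: it is the
    term by which the potential changes when the Leibniz rule is applied to
    [S^-1 (conj psi2, psi1)]. *)
Definition moutard_increment psi S (p : R * R) : C :=
  let chi := inverted_spinor psi S in
  'i%C * (conjc (comp2 chi p) * comp2 psi p + comp1 chi p * conjc (comp1 psi p)).

Lemma moutard_K00 psi S p : S p != 0 ->
  - 'i%C * moutard_K psi S p 0 0 = moutard_increment psi S p.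
Proof.
move=> Sp0; have invG : invmx (Gamma R) = mat2 0 (-1) 1 0.
  apply/esym/invmx_right; rewrite mat2M -mat2_1.
  by congr mat2; ring.
have Psi0T : (Psi0 psi p)^T = mat2 (comp1 psi p) (comp2 psi p)
    (- conjc (comp2 psi p)) (conjc (comp1 psi p)).
  by apply/matrixP => [] [[|[|//]] ?] [[|[|//]] ?]; rewrite !mxE.
rewrite /moutard_K invG Psi0T -su2_inversion // /Psi0 /Gamma su2E !mat2M mat2E.
rewrite /moutard_increment conj_comp2_inverted comp1_inverted.
by ring: ii.
Qed.

Lemma moutard_increment_real psi S p :
  conjc (moutard_increment psi S p) = moutard_increment psi S p.
Proof.
rewrite /moutard_increment conj_comp2_inverted comp1_inverted.
case: (xminus _) (comp1 _ _) (comp2 _ _) => m1 m2 [a1 a2].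
by move=> [b1 b2]; apply/eqP; rewrite eq_complex /=; apply/andP;
  split; apply/eqP; ring.
Qed.

Lemma moutard_incrementJ psi S p : moutard_increment psi S p =
  - 'i%C * (comp2 (inverted_spinor psi S) p * conjc (comp2 psi p) +
            conjc (comp1 (inverted_spinor psi S) p) * comp1 psi p).
Proof.
rewrite -moutard_increment_real /moutard_increment rmorphM rmorphD !rmorphM.
by rewrite -conjc_i; congr (_ * (_ * _ + _ * _)); exact: conjcK.
Qed.

Lemma moutard_increment_Re psi S p :
  (complex.Re (moutard_increment psi S p))%:C = moutard_increment psi S p.
Proof.
have := moutard_increment_real psi S p.
case: (moutard_increment _ _ _) => w v /= [] /eqP.
by rewrite eqNr => /eqP ->.
Qed.

(** The matrix [S^-1], which carries one spinor to the other, is invertible. *)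
Lemma inverted_spinor_neq0 psi S p : S p != 0 -> psi p != 0 ->
  inverted_spinor psi S p != 0.
Proof.
move=> Sp0; have n0 : norm2 (inversion (S p)) != 0.
  rewrite norm2_eq0 /inversion; rewrite scaler_eq0 oppr_eq0 invr_eq0.
  by rewrite -/(norm2 _) norm2_eq0 (negPf Sp0).
have N0 : (norm2 (inversion (S p)))%:C != 0 by rewrite eq_complex /= eqxx andbT.
rewrite norm2_xminus in N0.
apply: contraNneq => chi0; rewrite spinor_eq0 -/(comp1 psi p) -/(comp2 psi p).
have c1 : comp1 (inverted_spinor psi S) p = 0 by rewrite /comp1 chi0 mxE.
have c2 : conjc (comp2 (inverted_spinor psi S) p) = 0.
  by rewrite /comp2 chi0 mxE conjc0.
rewrite comp1_inverted in c1; rewrite conj_comp2_inverted in c2.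
move: c1 c2 N0; set m := xminus _; set y := (_)%:C.
move=> c1 c2; set N := _ + _ => N0.
(* Multiplying the new spinor by S^-1 once more gives - N times the old one. *)
have a0 : N * comp1 psi p =
    'i%C * y * (m * conjc (comp2 psi p) - 'i%C * y * comp1 psi p) -
    m * ('i%C * y * conjc (comp2 psi p) - conjc m * comp1 psi p).
  by rewrite /N; ring: ii.
have b0 : N * conjc (comp2 psi p) =
    conjc m * (m * conjc (comp2 psi p) - 'i%C * y * comp1 psi p) -
    'i%C * y * ('i%C * y * conjc (comp2 psi p) - conjc m * comp1 psi p).
  by rewrite /N; ring: ii.
move/eqP: a0; rewrite c1 c2 !mulr0 subr0 mulf_eq0 (negPf N0) /= => ->.
by move/eqP: b0; rewrite c1 c2 !mulr0 subr0 mulf_eq0 (negPf N0) conjc_eq0.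
Qed.

Section Derivatives.
Variables (Omega : set (R * R)) (P0 : R * R) (U : R * R -> R).
Variables (psi : R * R -> 'cV[C]_2) (S : R * R -> 'rV[R]_3).
Hypotheses (oO : open Omega) (cO : connected Omega) (OP0 : Omega P0).
Hypotheses (hpsi : dirac_solution Omega U psi)
  (hS : weierstrass_surface Omega P0 psi S)
  (hS0 : forall p, Omega p -> S p != 0).

Local Notation chi := (inverted_spinor psi S).
Local Notation y3 := (fun p => (inversion (S p) 0 2)%:C).
Local Notation ym := (fun p => xminus (inversion (S p))).
Local Notation yp := (fun p => conjc (xminus (inversion (S p)))).

Lemma inversion_csmooth : [/\ csmooth Omega y3, csmooth Omega ym,
  csmooth Omega (fun p => (norm2 (S p))^-1%:C),
  csmooth Omega (fun p => (S p 0 2)%:C) & csmooth Omega (fun p => xminus (S p))].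
Proof.
have [s3 sm _] := surface_derivatives oO cO OP0 hpsi hS.
have sp := csmooth_conj oO sm.
have sn : smooth Omega (fun p => norm2 (S p)).
  have [+ _] := csmoothD oO (csmoothM oO sm sp) (csmoothM oO s3 s3).
  by apply: smooth_ext => // p _; rewrite -norm2_xminus.
have sv : csmooth Omega (fun p => (norm2 (S p))^-1%:C).
  apply: csmooth_real => //; apply: smoothV => // p Op.
  by rewrite norm2_eq0 hS0.
split=> //.
- apply: csmooth_ext (csmoothN oO (csmoothM oO sv s3)) => // p _.
  by rewrite inversion_x3.
- apply: csmooth_ext (csmoothN oO (csmoothM oO sv sm)) => // p _.
  by rewrite inversion_xminus.
Qed.

(** These are the entries of [(S^-1)_z = - S^-1 S_z S^-1], and they say that the
    inverted surface is the Weierstrass surface of [chi]. *)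
Lemma inversion_del p : Omega p ->
  [/\ del y3 p = comp1 chi p * conjc (comp2 chi p),
      del ym p = 'i%C * comp1 chi p ^+ 2 &
      del yp p = 'i%C * conjc (comp2 chi p) ^+ 2].
Proof.
move=> Op; have [sy3 sym sv s3 sm] := inversion_csmooth.
have [_ _ /(_ p Op)[d3 dm dmb]] := surface_derivatives oO cO OP0 hpsi hS.
have sp := csmooth_conj oO sm.
have dp : del (fun q => conjc (xminus (S q))) p =
    'i%C * conjc (comp2 psi p) ^+ 2.
  rewrite (del_conj Op sm) dmb -mulNr rmorphM rmorphXn; congr (_ * _).
  by rewrite -conjc_i; exact: conjcK.
have N0 q : Omega q -> norm2 (S q) != 0 by move=> /hS0; rewrite norm2_eq0.
have Nv := inv_norm2M (N0 p Op).
set v := (norm2 (S p))^-1%:C in Nv.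
(* The derivative of 1 / |S|^2, from the Leibniz rule for |S|^-2 |S|^2 = 1. *)
have dv : del (fun q => (norm2 (S q))^-1%:C) p = - (v * v *
    ('i%C * comp1 psi p ^+ 2 * conjc (xminus (S p)) +
     xminus (S p) * ('i%C * conjc (comp2 psi p) ^+ 2) +
     2 * (S p 0 2)%:C * (comp1 psi p * conjc (comp2 psi p)))).
  have : del (fun q => (norm2 (S q))^-1%:C * (xminus (S q) * conjc (xminus (S q))
      + (S q 0 2)%:C * (S q 0 2)%:C)) p = 0.
    rewrite -[RHS](del_cst p 1); apply: (del_ext oO Op) => q Oq.
    by rewrite -norm2_xminus -rmorphM mulVf ?N0.
  have smp := csmoothM oO sm sp; have s33 := csmoothM oO s3 s3.
  rewrite (delM Op sv (csmoothD oO smp s33)) (delD Op smp s33).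
  rewrite (delM Op sm sp) (delM Op s3 s3) d3 dm dp -/v.
  move: (del _ p) => dv E.
  have -> : dv = v * (dv * (xminus (S p) * conjc (xminus (S p)) +
      (S p 0 2)%:C * (S p 0 2)%:C)) by ring: Nv.
  move/eqP: E; rewrite addr_eq0 => /eqP ->; ring.
have inv_del (g gi : R * R -> C) : csmooth Omega g -> (forall q, Omega q ->
    gi q = - ((norm2 (S q))^-1%:C * g q)) ->
    del gi p = - (del (fun q => (norm2 (S q))^-1%:C) p * g p + v * del g p).
  move=> sg gE; rewrite -(delM Op sv sg) -mulN1r -(delZ oO Op _ (csmoothM oO sv sg)).
  by apply: (del_ext oO Op) => q Oq; rewrite gE // mulN1r.
rewrite (inv_del _ _ s3 (fun q _ => inversion_x3 (S q))).
rewrite (inv_del _ _ sm (fun q _ => inversion_xminus (S q))).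
rewrite (inv_del (fun q => conjc (xminus (S q))) yp sp); last first.
  by move=> q _; rewrite inversion_xminus conjc_oppM.
rewrite d3 dm dp dv comp1_inverted conj_comp2_inverted inversion_x3.
rewrite inversion_xminus conjc_oppM -/v.
by clear -ii Nv; split; ring: ii Nv.
Qed.

Lemma inverted_spinor_csmooth :
  csmooth Omega (comp1 chi) /\ csmooth Omega (comp2 chi).
Proof.
have [sy3 sym _ _ _] := inversion_csmooth; have [s1 s2 _] := hpsi.
have siy := csmoothM oO (csmooth_cst 'i%C oO) sy3.
split.
- apply: csmooth_ext (csmoothD oO (csmoothM oO sym (csmooth_conj oO s2))
    (csmoothN oO (csmoothM oO siy s1))) => // p _.
  by rewrite comp1_inverted.
- apply: csmooth_ext (csmoothN oO (csmoothD oO (csmoothM oO siy s2)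
    (csmoothM oO sym (csmooth_conj oO s1)))) => // p _.
  by rewrite comp2_inverted.
Qed.

(** Each component of [chi] is bilinear in [S^-1] and [psi].  Derivatives falling
    on [psi] reproduce [U] times the other component by the Dirac equation of
    [psi]; derivatives falling on [S^-1] are quadratic in [chi] by
    [inversion_del], and the common factor they leave is
    [moutard_increment]. *)
Lemma inverted_spinor_dirac p : Omega p ->
  del (comp2 chi) p =
    - (((U p)%:C + moutard_increment psi S p) * comp1 chi p) /\
  delbar (comp1 chi) p =
    ((U p)%:C + moutard_increment psi S p) * comp2 chi p.
Proof.
move=> Op; have [sy3 sym _ _ _] := inversion_csmooth; have [s1 s2 d] := hpsi.
have [d2 d1] := (dirac_eq0 U psi p).1 (d p Op).
have [e3 em ep] := inversion_del Op.
have c1 := csmooth_conj oO s1; have c2 := csmooth_conj oO s2.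
have siy := csmoothM oO (csmooth_cst 'i%C oO) sy3.
(* y3 is real and yp is the conjugate of ym, so their delbar-derivatives are
   conjugates of the del-derivatives already known. *)
have e3b : delbar y3 p = conjc (comp1 chi p) * comp2 chi p.
  have -> : delbar y3 p = delbar (fun q => conjc (y3 q)) p.
    by congr (delbar _ p); apply/funext => q; rewrite conjc_real.
  by rewrite (delbar_conj oO Op sy3) e3 rmorphM; congr (_ * _); exact: conjcK.
have emb : delbar ym p = - 'i%C * comp2 chi p ^+ 2.
  have -> : delbar ym p = delbar (fun q => conjc (yp q)) p.
    by congr (delbar _ p); apply/funext => q; rewrite conjcK.
  rewrite (delbar_conj oO Op (csmooth_conj oO sym)) ep rmorphM rmorphXn -conjc_i.
  by congr (_ * _ ^+ 2); exact: conjcK.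
have d1c : conjc (delbar (comp1 psi) p) = (U p)%:C * conjc (comp2 psi p).
  by rewrite d1 rmorphM; congr (_ * _); exact: conjc_real.
have d2c : conjc (del (comp2 psi) p) = - ((U p)%:C * conjc (comp1 psi p)).
  by rewrite d2 conjc_oppM.
split.
- have -> : del (comp2 chi) p = del (fun q => - 1 * ('i%C * y3 q * comp2 psi q +
      ym q * conjc (comp1 psi q))) p.
    by congr (del _ p); apply/funext => q; rewrite comp2_inverted mulN1r.
  rewrite (delZ oO Op _ (csmoothD oO (csmoothM oO siy s2) (csmoothM oO sym c1))).
  rewrite (delD Op (csmoothM oO siy s2) (csmoothM oO sym c1)).
  rewrite (delM Op siy s2) (delM Op sym c1) (delZ oO Op _ sy3).
  rewrite (del_conj Op s1) d1c d2 e3 em /moutard_increment.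
  move: (conjc (comp2 chi p)) => chi2c; rewrite comp1_inverted.
  by clear -ii; ring: ii.
- have -> : delbar (comp1 chi) p = delbar (fun q => ym q * conjc (comp2 psi q) +
      - 1 * ('i%C * y3 q * comp1 psi q)) p.
    by congr (delbar _ p); apply/funext => q; rewrite comp1_inverted mulN1r.
  have sm1 := csmoothM oO siy s1.
  rewrite (delbarD Op (csmoothM oO sym c2) (csmoothM oO (csmooth_cst _ oO) sm1)).
  rewrite (delbarZ oO Op _ sm1) (delbarM Op siy s1) (delbarM Op sym c2).
  rewrite (delbarZ oO Op _ sy3) (delbar_conj oO Op s2) d2c d1 e3b emb.
  rewrite moutard_incrementJ.
  move: (conjc (comp1 chi p)) => chi1c; rewrite comp2_inverted.
  by clear -ii; ring: ii.
Qed.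

Lemma inversion_smooth k :
  smooth Omega (Defs.coord (fun p => inversion (S p)) k).
Proof.
have [[s2 _] [sr si] _ _ _] := inversion_csmooth.
have [->|[->|->]] : k = 0 \/ k = 1 \/ k = 2.
  by case: k => [[|[|[|//]]] ?]; [left | right; left | right; right];
    apply/val_inj.
- by apply: smooth_ext sr => // p _; rewrite Re_xminus.
- by apply: smooth_ext (smoothN oO si) => // p _; rewrite Im_xminus opprK.
- exact: s2.
Qed.

Lemma inversion_weierstrass_equations :
  weierstrass_equations Omega chi (fun p => inversion (S p)).
Proof.
move=> p Op; have [sy3 sym _ _ _] := inversion_csmooth.
have [e3 em ep] := inversion_del Op; have syp := csmooth_conj oO sym.
have smn := csmoothM oO (csmooth_cst (-1) oO) sym.
split=> //=.
- have -> : del (fun q => (Defs.coord (fun r => inversion (S r)) 0 q)%:C) p =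
      del (fun q => 2^-1 * (ym q + yp q)) p.
    congr (del _ p); apply/funext => q; rewrite conj_xminus /xminus.
    by rewrite /Defs.coord; field.
  by rewrite (delZ oO Op _ (csmoothD oO sym syp)) (delD Op sym syp) em ep; ring.
- have -> : del (fun q => (Defs.coord (fun r => inversion (S r)) 1 q)%:C) p =
      del (fun q => - ('i%C / 2) * (yp q + -1 * ym q)) p.
    congr (del _ p); apply/funext => q; rewrite conj_xminus /xminus.
    by rewrite /Defs.coord; field: ii.
  rewrite (delZ oO Op _ (csmoothD oO syp smn)) (delD Op syp smn).
  by rewrite (delZ oO Op _ sym) em ep; ring: ii.
Qed.

End Derivatives.

End Inversion.

Theorem theorem2 (R : realType) (Omega : set (R * R)) (P0 : R * R)
    (U : R * R -> R) (psi : R * R -> 'cV[R[i]]_2) (S : R * R -> 'rV[R]_3)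
    (hOmega : simply_connected_domain Omega)
    (hP0 : Omega P0)
    (hU : smooth Omega U)
    (hpsi : dirac_solution Omega U psi)
    (hpsi0 : nowhere_vanishing Omega psi)
    (hS : weierstrass_surface Omega P0 psi S)
    (hS0 : forall p, Omega p -> S p != 0) :
  exists W : R * R -> R,
    (forall p, Omega p -> (W p)%:C = - 'i%C * moutard_K psi S p 0 0) /\
    (forall p, Omega p -> su2 (inversion (S p)) = invmx (su2 (S p))) /\
    is_potential Omega (fun p => inversion (S p)) (fun p => U p + W p).
Proof.
have [oO _ [cO _]] := hOmega.
have [sc1 sc2] := inverted_spinor_csmooth oO cO hP0 hpsi hS hS0.
have [s1 s2 _] := hpsi.
pose W p := complex.Re (moutard_increment psi S p).
have sW : smooth Omega W.
  have [] // := csmoothM oO (csmooth_cst 'i%C oO) (csmoothD oO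
    (csmoothM oO (csmooth_conj oO sc2) s2) (csmoothM oO sc1 (csmooth_conj oO s1))).
exists W; split.
  by move=> p Op; rewrite moutard_K00 ?hS0 // moutard_increment_Re.
split; first by move=> p Op; exact: su2_inversion (hS0 p Op).
have pot : has_weierstrass_potential Omega (fun p => inversion (S p))
    (fun p => U p + W p).
  split; first exact: smoothD.
    exact: inversion_smooth oO cO hP0 hpsi hS hS0.
  exists (inverted_spinor psi S); split.
  - split=> // p Op; apply/dirac_eq0.
    have := inverted_spinor_dirac oO cO hP0 hpsi hS hS0 Op.
    by rewrite -moutard_increment_Re -rmorphD.
  - by move=> p Op; apply: inverted_spinor_neq0; [exact: hS0 | exact: hpsi0].
  - exact: inversion_weierstrass_equations oO cO hP0 hpsi hS hS0.
by split=> // V hV p Op; exact: potential_unique pot hV p Op.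
Qed.
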